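(* Let $G$ be an arbitrary (possibly infinite) group, let $R$ be a ring, and let $S=R\star_\alpha^wG$ be a unital partial crossed product of $G$ over $R$. Then $S/R$ is separable if and only if $1\in\mathrm{tr}_\alpha(Z(R)_{\alpha,{\rm fin}})$.
   Context: Rings are associative with a nonzero multiplicative identity $1$, except that ideals $D_g$ below are viewed as rings whose identity may be $0$. $Z(R)$ is the center of $R$; $XY$ denotes the set of finite sums of products $xy$ with $x \in X$, $y\in Y$. Let $e$ be the identity of $G$. Unital twisted partial action of $G$ on $R$: a triple $\alpha=(\{D_g\}_{g\in G},\{\alpha_g\}_{g\in G},\{w_{g,h}\}_{(g,h)\in G\times G})$ where for each $g$, $D_g$ is an ideal of $R$ having a (not necessarily nonzero) multiplicative identity element $1_g$, which is central in $R$; $\alpha_g:D_{g^{-1}}\to D_g$ is an isomorphism of rings; and each $w_{g,h}$ is an invertible element of $D_gD_{gh}$ (a ring with identity $1_g1_{gh}$), such that for all $g,h,l\in G$: (P1) $\alpha_e=\mathrm{id}_R$; (P2) $\alpha_g(D_{g^{-1}}D_h)=D_gD_{gh}$; (P3) if $r\in D_{h^{-1}}D_{(gh)^{-1}}$, then $\alpha_g(\alpha_h(r))=w_{g,h}\alpha_{gh}(r)w_{g,h}^{-1}$; (P4) $w_{e,g}=w_{g,e}=1_g$; (P5) if $r\in D_{g^{-1}}D_hD_{hl}$, then $\alpha_g(rw_{h,l})w_{g,hl}=\alpha_g(r)w_{g,h}w_{gh,l}$. Unital partial crossed product: $R\star_\alpha^wG=\bigoplus_{g\in G}D_g\delta_g$,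 where the $\delta_g$ are formal symbols, with multiplication given by biadditive extension of (P6) $(r\delta_g)(r'\delta_h)=r\alpha_g(r'1_{g^{-1}})w_{g,h}\delta_{gh}$ for $g,h\in G$, $r\in D_g$, $r'\in D_h$. It is an associative ring, and $R$ is regarded as a subring via $r\mapsto r\delta_e$. Trace: $Z(R)_{\alpha,{\rm fin}}$ is the set of $r\in Z(R)$ such that $r1_g=0$ for all but finitely many $g\in G$, and $\mathrm{tr}_\alpha:Z(R)_{\alpha,{\rm fin}}\to Z(R)$ is $\mathrm{tr}_\alpha(r)=\sum_{g\in G}\alpha_g(r1_{g^{-1}})$. Separability: $S/R$ is separable if there is $x\in S\otimes_RS$ with $m(x)=1$, where $m:S\otimes_RS\to S$ is the multiplication map, and $sx=xs$ for all $s\in S$. *)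

(* Defs.v *)
From HB Require Import structures.
From mathcomp Require Import all_boot all_order all_algebra.
From mathcomp Require Import finmap.
From mathcomp Require Import boolp classical_sets functions cardinality fsbigop.
From mathcomp.multinomials Require Import monalg.

Set Implicit Arguments.
Unset Strict Implicit.
Unset Printing Implicit Defensive.

Import GRing.Theory.

Local Open Scope classical_set_scope.
Local Open Scope ring_scope.
Local Open Scope quotient_scope.

Definition center (R : nzRingType) : set R :=
  [set r | forall x, r * x = x * r].

Definition two_sided_ideal (R : nzRingType) (I : set R) : Prop :=
  [/\ I 0, forall x y, I x -> I y -> I (x - y)
    & forall a x, I x -> I (a * x) /\ I (x * a)].

Definition mul_set (R : nzRingType) (X Y : set R) : set R :=
  [set r | exists2 s : seq (R * R),
     (forall p, p \in s -> X p.1 /\ Y p.2) & r = \sum_(p <- s) p.1 * p.2].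

(* [tpa_map g] is the isomorphism from [tpa_dom g^-1] onto [tpa_dom g]; its    *)
(* values outside [tpa_dom g^-1] are irrelevant.  [tpa_id g] is the identity   *)
(* of [tpa_dom g], and [tpa_cocV g h] the inverse of [tpa_coc g h] in the ring *)
(* D_g D_gh, whose identity is [tpa_id g * tpa_id (g * h)]; both are uniquely  *)
(* determined by the other data.                                               *)
Record twisted_partial_action (G : groupType) (R : nzRingType) := TPA {
  tpa_dom : G -> set R;
  tpa_id : G -> R;
  tpa_map : G -> R -> R;
  tpa_coc : G -> G -> R;
  tpa_cocV : G -> G -> R;

  tpa_dom_ideal : forall g, two_sided_ideal (tpa_dom g);
  tpa_id_dom : forall g, tpa_dom g (tpa_id g);
  tpa_id_center : forall g, center (tpa_id g);
  tpa_idl : forall g r, tpa_dom g r -> tpa_id g * r = r;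

  tpa_map_bij : forall g,
    set_bij (tpa_dom g^-1%g) (tpa_dom g) (tpa_map g);
  tpa_mapD : forall g r s, tpa_dom g^-1%g r -> tpa_dom g^-1%g s ->
    tpa_map g (r + s) = tpa_map g r + tpa_map g s;
  tpa_mapM : forall g r s, tpa_dom g^-1%g r -> tpa_dom g^-1%g s ->
    tpa_map g (r * s) = tpa_map g r * tpa_map g s;

  tpa_coc_dom : forall g h,
    mul_set (tpa_dom g) (tpa_dom (g * h)%g) (tpa_coc g h);
  tpa_cocV_dom : forall g h,
    mul_set (tpa_dom g) (tpa_dom (g * h)%g) (tpa_cocV g h);
  tpa_cocK : forall g h,
    tpa_coc g h * tpa_cocV g h = tpa_id g * tpa_id (g * h)%g;
  tpa_cocVK : forall g h,
    tpa_cocV g h * tpa_coc g h = tpa_id g * tpa_id (g * h)%g;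

  tpa_dom1 : tpa_dom 1%g = setT;
  tpa_map1 : forall r, tpa_map 1%g r = r;
  tpa_map_dom : forall g h,
    tpa_map g @` mul_set (tpa_dom g^-1%g) (tpa_dom h) =
    mul_set (tpa_dom g) (tpa_dom (g * h)%g);
  tpa_map_comp : forall g h r,
    mul_set (tpa_dom h^-1%g) (tpa_dom (g * h)^-1%g) r ->
    tpa_map g (tpa_map h r) =
    tpa_coc g h * tpa_map (g * h)%g r * tpa_cocV g h;
  tpa_coc1g : forall g, tpa_coc 1%g g = tpa_id g;
  tpa_cocg1 : forall g, tpa_coc g 1%g = tpa_id g;
  tpa_cocycle : forall g h l r,
    mul_set (mul_set (tpa_dom g^-1%g) (tpa_dom h)) (tpa_dom (h * l)%g) r ->
    tpa_map g (r * tpa_coc h l) * tpa_coc g (h * l)%g =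
    tpa_map g r * tpa_coc g h * tpa_coc (g * h)%g l
}.

Section Trace.
Context (G : groupType) (R : nzRingType) (A : twisted_partial_action G R).

Definition center_fin : set R :=
  [set r | center r /\ finite_set [set g | r * tpa_id A g != 0]].

(* Meaningful on [center_fin], where the sum has finite support; see           *)
(* [trace_finite_support].                                                     *)
Definition trace (r : R) : R :=
  \sum_(g \in [set: G]) tpa_map A g (r * tpa_id A g^-1%g).

End Trace.

Section PartialActionTheory.
Context (G : groupType) (R : nzRingType) (A : twisted_partial_action G R).
Local Notation D := (tpa_dom A).
Local Notation "''1_' g" := (tpa_id A g) (at level 8, g at level 2).
Local Notation al := (tpa_map A).
Local Notation w := (tpa_coc A).
Local Notation wV := (tpa_cocV A).
Implicit Types (g h l : G) (a b c r s : R).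

Lemma tpa_dom0 g : D g 0. Proof. by case: (tpa_dom_ideal A g). Qed.

Lemma tpa_domB g r s : D g r -> D g s -> D g (r - s).
Proof. by case: (tpa_dom_ideal A g) => _ + _; apply. Qed.

Lemma tpa_domN g r : D g r -> D g (- r).
Proof. by move=> Dr; rewrite -sub0r; apply: tpa_domB => //; apply: tpa_dom0. Qed.

Lemma tpa_domD g r s : D g r -> D g s -> D g (r + s).
Proof. by move=> Dr /tpa_domN Ds; rewrite -[s]opprK; apply: tpa_domB. Qed.

Lemma tpa_domMl g a r : D g r -> D g (a * r).
Proof. by case: (tpa_dom_ideal A g) => _ _ /[apply]/(_ a)[]. Qed.

Lemma tpa_domMr g a r : D g r -> D g (r * a).
Proof. by case: (tpa_dom_ideal A g) => _ _ /[apply]/(_ a)[]. Qed.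

Lemma tpa_dom_sum g (I : Type) (s : seq I) (P : pred I) (F : I -> R) :
  (forall i, P i -> D g (F i)) -> D g (\sum_(i <- s | P i) F i).
Proof. by move=> DF; elim/big_ind: _ => //; [apply: tpa_dom0|apply: tpa_domD]. Qed.

Lemma tpa_idC g r : '1_g * r = r * '1_g.
Proof. exact: (tpa_id_center A g). Qed.

Lemma tpa_idr g r : D g r -> r * '1_g = r.
Proof. by move=> Dr; rewrite -tpa_idC tpa_idl. Qed.

Lemma tpa_dom_idr g r : D g (r * '1_g).
Proof. by apply: tpa_domMl; apply: tpa_id_dom. Qed.

Lemma tpa_id1 : '1_1%g = 1.
Proof. by rewrite -[RHS](@tpa_idl _ _ A 1%g) ?mulr1// tpa_dom1. Qed.

Lemma mul_setM (X Y : set R) a b : X a -> Y b -> mul_set X Y (a * b).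
Proof.
move=> Xa Yb; exists [:: (a, b)]; last by rewrite big_seq1.
by move=> p; rewrite inE => /eqP ->.
Qed.

Lemma mul_dom_l g h r : mul_set (D g) (D h) r -> D g r.
Proof.
by move=> [s Hs ->]; rewrite big_seq; apply: tpa_dom_sum => p /Hs[? ?];
  apply: tpa_domMr.
Qed.

Lemma mul_dom_r g h r : mul_set (D g) (D h) r -> D h r.
Proof.
by move=> [s Hs ->]; rewrite big_seq; apply: tpa_dom_sum => p /Hs[? ?];
  apply: tpa_domMl.
Qed.

Lemma mul_domP g h r : D g r -> D h r -> mul_set (D g) (D h) r.
Proof. by move=> Dg Dh; rewrite -(tpa_idl Dg); apply: mul_setM => //; apply: tpa_id_dom. Qed.

Lemma tpa_map_domP g r : D g^-1%g r -> D g (al g r).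
Proof. by case: (tpa_map_bij A g) => + _ _; apply. Qed.

Lemma tpa_map0 g : al g 0 = 0.
Proof. by apply: (addIr (al g 0)); rewrite -tpa_mapD ?addr0 ?add0r//; apply: tpa_dom0. Qed.

(* al_g restricts to an isomorphism D_{g^-1} D_h -> D_g D_gh, so it preserves *)
(* the identities of these ideals.                                            *)
Lemma tpa_map_id g h : al g ('1_(g^-1)%g * '1_h) = '1_g * '1_(g * h)%g.
Proof.
set e := '1_(g^-1)%g * '1_h; set v := '1_g * '1_(g * h)%g.
have He : mul_set (D g^-1%g) (D h) e by apply: mul_setM; apply: tpa_id_dom.
have Hu : mul_set (D g) (D (g * h)%g) (al g e).
  by rewrite -tpa_map_dom; exists e.
have uv : al g e * v = al g e.
  by rewrite mulrA (tpa_idr (mul_dom_l Hu)) (tpa_idr (mul_dom_r Hu)).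
have: mul_set (D g) (D (g * h)%g) v by apply: mul_setM; apply: tpa_id_dom.
rewrite -tpa_map_dom => -[r Hr Er].
rewrite -uv -Er -tpa_mapM; [|exact: mul_dom_l He|exact: mul_dom_l Hr].
by rewrite -mulrA (tpa_idl (mul_dom_r Hr)) (tpa_idl (mul_dom_l Hr)).
Qed.

Lemma tpa_idAC g h r : r * '1_g * '1_h = r * '1_h * '1_g.
Proof. by rewrite -mulrA tpa_idC mulrA. Qed.

Lemma tpa_map_idM g h r :
  al g (r * '1_(g^-1)%g * '1_h) = al g (r * '1_(g^-1)%g) * '1_(g * h)%g.
Proof.
have Dg := tpa_dom_idr (g^-1)%g r.
have De : D g^-1%g ('1_(g^-1)%g * '1_h) by apply/tpa_domMr/tpa_id_dom.
rewrite -{1}(tpa_idr Dg) -[_ * _ * '1_h]mulrA (tpa_mapM Dg De) tpa_map_id mulrA.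
by rewrite (tpa_idr (tpa_map_domP Dg)).
Qed.

(* Coefficient of (r delta_g)(s delta_h) at gh. *)
Definition cp_coef g h r s : R := r * al g (s * '1_(g^-1)%g) * w g h.

Lemma cp_coef_dom g h r s : D (g * h)%g (cp_coef g h r s).
Proof. by apply: tpa_domMl; apply: mul_dom_r (tpa_coc_dom A g h). Qed.

Lemma cp_coefDl g h r r' s :
  cp_coef g h (r + r') s = cp_coef g h r s + cp_coef g h r' s.
Proof. by rewrite /cp_coef !mulrDl. Qed.

Lemma cp_coefDr g h r s s' :
  cp_coef g h r (s + s') = cp_coef g h r s + cp_coef g h r s'.
Proof. by rewrite /cp_coef mulrDl tpa_mapD ?mulrDr ?mulrDl//; apply: tpa_dom_idr. Qed.

Lemma cp_coef0l g h s : cp_coef g h 0 s = 0.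
Proof. by rewrite /cp_coef !mul0r. Qed.

Lemma cp_coef0r g h r : cp_coef g h r 0 = 0.
Proof. by rewrite /cp_coef mul0r tpa_map0 mulr0 mul0r. Qed.

Lemma cp_coef1l g r : D g r -> cp_coef 1%g g 1 r = r.
Proof.
by move=> Dr; rewrite /cp_coef tpa_coc1g mul1r tpa_map1 invg1 tpa_id1 mulr1 tpa_idr.
Qed.

Lemma cp_coef1r g r : D g r -> cp_coef g 1%g r 1 = r.
Proof.
move=> Dr; rewrite /cp_coef tpa_cocg1 mul1r.
have := tpa_map_id g 1%g; rewrite tpa_id1 mulr1 mulg1 => ->.
by rewrite mulrA !tpa_idr.
Qed.

Lemma cp_coefA g h l a b c :
  cp_coef g (h * l)%g a (cp_coef h l b c) = cp_coef (g * h)%g l (cp_coef g h a b) c.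
Proof.
set k := (g * h)%g.
pose y := c * '1_(h^-1)%g * '1_l * '1_(k^-1)%g.
have Ex : al h y = al h (c * '1_(h^-1)%g) * '1_(h * l)%g * '1_(g^-1)%g.
  rewrite /y [c * _ * _]tpa_idAC tpa_map_idM -tpa_idAC tpa_map_idM.
  by rewrite /k invgM mulgA mulgV mul1g.
have Dx : D g^-1%g (al h y) by rewrite Ex; apply: tpa_dom_idr.
have Dxh : D h (al h y).
  by rewrite Ex; do 2!apply: tpa_domMr; apply: tpa_map_domP; apply: tpa_dom_idr.
have Dxhl : D (h * l)%g (al h y).
  by rewrite Ex; apply: tpa_domMr; apply: tpa_dom_idr.
have Db := tpa_dom_idr (g^-1)%g b.
pose r := b * '1_(g^-1)%g * al h y.
have Hr : mul_set (mul_set (D g^-1%g) (D h)) (D (h * l)%g) r.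
  rewrite -[r](@tpa_idr (h * l)%g); last by apply: tpa_domMl.
  apply: mul_setM; last exact: tpa_id_dom.
  by apply: mul_domP; [apply: tpa_domMl|apply: tpa_domMl].
have Erw : b * al h (c * '1_(h^-1)%g) * w h l * '1_(g^-1)%g = r * w h l.
  have Dw := mul_dom_r (tpa_coc_dom A h l).
  rewrite /r -(mulrA b _ (al h y)) (tpa_idl Dx) Ex.
  rewrite -!mulrA (tpa_idC _ (w h l)) [in RHS](mulrA _ (w h l)) (tpa_idl Dw).
  by [].
rewrite /cp_coef Erw -!(mulrA a) (tpa_cocycle Hr); congr (a * _).
rewrite /r (tpa_mapM Db Dx) (tpa_map_comp (r := y)); last first.
  by apply: mul_domP; rewrite /y; [do 2!apply: tpa_domMr|]; apply: tpa_dom_idr.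
rewrite -!mulrA; congr (_ * _).
have Ey : al k y = al k (c * '1_(k^-1)%g) * '1_g * '1_(k * l)%g.
  by rewrite /y tpa_idAC tpa_map_idM [c * _ * _]tpa_idAC tpa_map_idM /k mulgK.
have Dwl := mul_dom_l (tpa_coc_dom A k l).
have Dwr := mul_dom_r (tpa_coc_dom A k l).
have Dw := mul_dom_l (tpa_coc_dom A g h).
rewrite -/k Ey (mulrA (wV g h)) tpa_cocVK -/k -!mulrA (tpa_idl Dwl).
rewrite (tpa_idC g (w k l)) (mulrA '1_(k * l)%g) (tpa_idl Dwr).
rewrite (tpa_idC g (w k l * _)) -(mulrA (w k l)) (tpa_idl (tpa_id_dom A g)).
by rewrite (mulrA _ (w k l)) -tpa_idC mulrA (tpa_idr Dw).
Qed.

Lemma trace_finite_support r : center_fin A r ->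
  finite_set [set g | al g (r * '1_(g^-1)%g) != 0].
Proof.
move=> [_ rfin]; apply: sub_finite_set (finite_image (fun g => g^-1%g) rfin).
move=> g /= alg; exists (g^-1)%g; last by rewrite invgK.
by apply: contra_neq alg => ->; rewrite tpa_map0.
Qed.

End PartialActionTheory.

Section CrossedProduct.
Context (G : groupType) (R : nzRingType) (A : twisted_partial_action G R).
Local Notation D := (tpa_dom A).
Implicit Types (x y z : {malg R[G]}) (g h : G) (r s : R).

Definition cp_pred : {pred {malg R[G]}} :=
  [pred x : {malg R[G]} | `[< forall g, D g x@_g >]].

Lemma cp_predP x : reflect (forall g, D g x@_g) (x \in cp_pred).
Proof. exact: asboolP. Qed.

(* The direct sum of the D_g delta_g: [<< r *g g >>] plays the role of        *)
(* r delta_g, and [cp_val f]@_g is the coefficient of f at g.                 *)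
Record crossed_product := CrossedProduct {
  cp_val : {malg R[G]};
  cp_valP : cp_val \in cp_pred
}.

Lemma cp_zmod_closed : zmod_closed cp_pred.
Proof.
split=> [|x y /cp_predP xD /cp_predP yD]; apply/cp_predP => g.
  by rewrite mcoeff0; apply: tpa_dom0.
by rewrite mcoeffB; apply: tpa_domB.
Qed.

HB.instance Definition _ := GRing.isZmodClosed.Build _ cp_pred cp_zmod_closed.
HB.instance Definition _ := [isSub for cp_val].
HB.instance Definition _ := [Choice of crossed_product by <:].
HB.instance Definition _ := [SubChoice_isSubZmodule of crossed_product by <:].

Definition cp_mul_raw x y : {malg R[G]} :=
  \sum_(g <- msupp x) \sum_(h <- msupp y)
    << cp_coef A g h x@_g y@_h *g (g * h)%g >>.

Lemma cp_mul_rawE (d e : {fset G}) x y :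
  (msupp x `<=` d)%fset -> (msupp y `<=` e)%fset ->
  cp_mul_raw x y = \sum_(g <- d) \sum_(h <- e)
    << cp_coef A g h x@_g y@_h *g (g * h)%g >>.
Proof.
move=> xd ye; rewrite /cp_mul_raw (big_fset_incl _ xd) /=; last first.
  move=> g _ /mcoeff_outdom ->; rewrite big1// => h _.
  by rewrite cp_coef0l monalgU0.
apply: eq_bigr => g _; apply: big_fset_incl => // h _ /mcoeff_outdom ->.
by rewrite cp_coef0r monalgU0.
Qed.

Lemma cp_mul_rawDl : left_distributive cp_mul_raw +%R.
Proof.
move=> x y z; pose d := (msupp x `|` msupp y)%fset.
rewrite !(@cp_mul_rawE d (msupp z)) ?fsubsetUl ?fsubsetUr ?msuppD_le//.
rewrite -big_split; apply: eq_bigr => g _; rewrite -big_split.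
by apply: eq_bigr => h _; rewrite mcoeffD cp_coefDl monalgUD.
Qed.

Lemma cp_mul_rawDr : right_distributive cp_mul_raw +%R.
Proof.
move=> z x y; pose d := (msupp x `|` msupp y)%fset.
rewrite !(@cp_mul_rawE (msupp z) d) ?fsubsetUl ?fsubsetUr ?msuppD_le//.
rewrite -big_split; apply: eq_bigr => g _; rewrite -big_split.
by apply: eq_bigr => h _; rewrite mcoeffD cp_coefDr monalgUD.
Qed.

Lemma cp_mul_raw0l x : cp_mul_raw 0 x = 0.
Proof. by rewrite /cp_mul_raw msupp0 big_seq_fset0. Qed.

Lemma cp_mul_raw0r x : cp_mul_raw x 0 = 0.
Proof. by rewrite /cp_mul_raw msupp0 big1// => g _; rewrite big_seq_fset0. Qed.

Lemma cp_mul_raw_suml (I : Type) (s : seq I) (F : I -> {malg R[G]}) y :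
  cp_mul_raw (\sum_(i <- s) F i) y = \sum_(i <- s) cp_mul_raw (F i) y.
Proof.
exact: (big_morph (cp_mul_raw^~ y) (fun _ _ => cp_mul_rawDl _ _ _)
  (cp_mul_raw0l y)).
Qed.

Lemma cp_mul_raw_sumr (I : Type) (s : seq I) (F : I -> {malg R[G]}) x :
  cp_mul_raw x (\sum_(i <- s) F i) = \sum_(i <- s) cp_mul_raw x (F i).
Proof.
exact: (big_morph (cp_mul_raw x) (fun _ _ => cp_mul_rawDr _ _ _)
  (cp_mul_raw0r x)).
Qed.

Lemma cp_mul_rawU r g s h :
  cp_mul_raw << r *g g >> << s *g h >> = << cp_coef A g h r s *g (g * h)%g >>.
Proof. by rewrite (cp_mul_rawE msuppU_le msuppU_le) !big_seq_fset1 !mcoeffUU. Qed.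

Lemma cp_mul_rawA : associative cp_mul_raw.
Proof.
move=> x y z; rewrite [x]monalgE !cp_mul_raw_suml; apply: eq_bigr => g _.
rewrite [y]monalgE cp_mul_raw_suml !cp_mul_raw_sumr cp_mul_raw_suml.
apply: eq_bigr => h _; rewrite [z]monalgE !cp_mul_raw_sumr.
by apply: eq_bigr => l _; rewrite !cp_mul_rawU cp_coefA mulgA.
Qed.

Lemma cp_predU r g : D g r -> << r *g g >> \in cp_pred.
Proof.
by move=> Dr; apply/cp_predP => h; rewrite mcoeffU; case: eqP => [<-//|_];
  apply: tpa_dom0.
Qed.

Lemma cp_mul_subproof x y : cp_mul_raw x y \in cp_pred.
Proof.
do 2!(rewrite rpred_sum// => ? _).
by apply: cp_predU; apply: cp_coef_dom.
Qed.

Definition cp_mul (f k : crossed_product) : crossed_product :=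
  CrossedProduct (cp_mul_subproof (cp_val f) (cp_val k)).

Lemma cp_base_subproof r : << r *g 1%g >> \in cp_pred.
Proof. by apply: cp_predU; rewrite tpa_dom1. Qed.

(* r |-> r delta_1 *)
Definition cp_base r : crossed_product := CrossedProduct (cp_base_subproof r).

Lemma cp_mulA : associative cp_mul.
Proof. by move=> x y z; apply/val_inj/cp_mul_rawA. Qed.

Lemma cp_mul1l : left_id (cp_base 1) cp_mul.
Proof.
move=> x; apply/val_inj => /=; have /cp_predP xD := cp_valP x.
rewrite [in LHS](monalgE (cp_val x)) cp_mul_raw_sumr [RHS]monalgE.
by apply: eq_bigr => g _; rewrite cp_mul_rawU cp_coef1l ?mul1g.
Qed.

Lemma cp_mul1r : right_id (cp_base 1) cp_mul.
Proof.
move=> x; apply/val_inj => /=; have /cp_predP xD := cp_valP x.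
rewrite [in LHS](monalgE (cp_val x)) cp_mul_raw_suml [RHS]monalgE.
by apply: eq_bigr => g _; rewrite cp_mul_rawU cp_coef1r ?mulg1.
Qed.

Lemma cp_mulDl : left_distributive cp_mul +%R.
Proof. by move=> x y z; apply/val_inj/cp_mul_rawDl. Qed.

Lemma cp_mulDr : right_distributive cp_mul +%R.
Proof. by move=> x y z; apply/val_inj/cp_mul_rawDr. Qed.

Lemma cp_oner_neq0 : cp_base 1 != 0.
Proof.
apply/eqP => /(congr1 (fun f => (cp_val f)@_1%g)) /=.
by rewrite mcoeffUU mcoeff0 => /eqP; rewrite oner_eq0.
Qed.

HB.instance Definition _ := GRing.Zmodule_isNzRing.Build crossed_product
  cp_mulA cp_mul1l cp_mul1r cp_mulDl cp_mulDr cp_oner_neq0.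

Lemma cp_base_zmod_morphism : zmod_morphism cp_base.
Proof. by move=> r s; apply/val_inj; rewrite /= monalgUB. Qed.

Lemma cp_base_monoid_morphism : monoid_morphism cp_base.
Proof.
split=> // r s; apply/val_inj; rewrite /= cp_mul_rawU mulg1.
by rewrite /cp_coef tpa_map1 tpa_cocg1 invg1 tpa_id1 !mulr1.
Qed.

HB.instance Definition _ :=
  GRing.isZmodMorphism.Build R crossed_product cp_base cp_base_zmod_morphism.
HB.instance Definition _ :=
  GRing.isMonoidMorphism.Build R crossed_product cp_base cp_base_monoid_morphism.

Lemma cp_base_inj : injective cp_base.
Proof. by move=> r s /(congr1 (fun f => (cp_val f)@_1%g)) /=; rewrite !mcoeffUU. Qed.

End CrossedProduct.

(* S (x)_R S for a ring morphism phi : R -> S, as the quotient of the free    *)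
(* abelian group on S * S by the subgroup generated by [tensor_gen].           *)
Section Tensor.
Context (R S : nzRingType) (phi : {rmorphism R -> S}).
Local Notation FreeSS := {malg int[(S * S)%type]}.
Implicit Types (a b s : S) (r : R) (x y : FreeSS).

Variant tensor_gen : FreeSS -> Prop :=
| TensorAddl a a' b :
    tensor_gen (<< (a + a', b) >> - << (a, b) >> - << (a', b) >>)
| TensorAddr a b b' :
    tensor_gen (<< (a, b + b') >> - << (a, b) >> - << (a, b') >>)
| TensorBal a r b :
    tensor_gen (<< (a * phi r, b) >> - << (a, phi r * b) >>).

Definition tensor_rel : {pred FreeSS} :=
  [pred x : FreeSS | `[< forall I : {pred FreeSS},
    zmod_closed I -> (forall y, tensor_gen y -> y \in I) -> x \in I >]].

Lemma tensor_relP x :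
  reflect (forall I : {pred FreeSS}, zmod_closed I ->
    (forall y, tensor_gen y -> y \in I) -> x \in I) (x \in tensor_rel).
Proof. exact: asboolP. Qed.

Lemma tensor_rel_zmod_closed : zmod_closed tensor_rel.
Proof.
split=> [|x y /tensor_relP xR /tensor_relP yR]; apply/tensor_relP => I cI gI.
  by case: cI.
by case: (cI) => _; apply; [apply: xR|apply: yR].
Qed.

HB.instance Definition _ :=
  GRing.isZmodClosed.Build _ tensor_rel tensor_rel_zmod_closed.

Definition tensor : Type := Quotient.quot tensor_rel.

HB.instance Definition _ := GRing.Zmodule.on tensor.
HB.instance Definition _ := EqQuotient.on tensor.

Definition tens a b : tensor := \pi_tensor << (a, b) >>.

Section Lift.
Context (V : zmodType) (f : S -> S -> V).

Definition balanced : Prop :=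
  [/\ forall a a' b, f (a + a') b = f a b + f a' b,
      forall a b b', f a (b + b') = f a b + f a b'
    & forall a r b, f (a * phi r) b = f a (phi r * b)].

Definition formal_lift x : V := \sum_(p <- msupp x) f p.1 p.2 *~ x@_p.

(* The additive map a (x) b |-> f a b, meaningful when f is [balanced].        *)
Definition tensor_lift (t : tensor) : V := formal_lift (repr t).

Lemma formal_liftE (d : {fset (S * S)%type}) x : (msupp x `<=` d)%fset ->
  formal_lift x = \sum_(p <- d) f p.1 p.2 *~ x@_p.
Proof.
by move=> xd; apply: big_fset_incl => // p _ /mcoeff_outdom ->; rewrite mulr0z.
Qed.

Lemma formal_liftB : {morph formal_lift : x y / x - y}.
Proof.
move=> x y; pose d := (msupp x `|` msupp y)%fset.
rewrite !(@formal_liftE d) ?fsubsetUl ?fsubsetUr ?msuppB_le// -sumrB.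
by apply: eq_bigr => p _; rewrite mcoeffB mulrzBr.
Qed.

Lemma formal_liftU a b : formal_lift << (a, b) >> = f a b.
Proof. by rewrite (formal_liftE msuppU_le) big_seq_fset1 mcoeffUU mulr1z. Qed.

Hypothesis fP : balanced.

Lemma formal_lift_rel x : x \in tensor_rel -> formal_lift x = 0.
Proof.
case: fP => fDl fDr fM /tensor_relP xR.
apply/eqP; apply: (xR [pred y | formal_lift y == 0]) => [|y].
  split=> [|u v]; rewrite !inE.
    by rewrite /formal_lift msupp0 big_seq_fset0.
  by move=> /eqP uE /eqP vE; rewrite formal_liftB uE vE subrr.
rewrite inE; case=> [a a' b|a b b'|a r b]; rewrite !formal_liftB !formal_liftU.
- by rewrite fDl -addrA -opprD subrr.
- by rewrite fDr -addrA -opprD subrr.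
- by rewrite fM subrr.
Qed.

Lemma tensor_lift_pi x : tensor_lift (\pi_tensor x) = formal_lift x.
Proof.
apply/eqP; rewrite -subr_eq0 -formal_liftB; apply/eqP/formal_lift_rel.
by rewrite Quotient.idealrBE reprK.
Qed.

Lemma tensor_liftE a b : tensor_lift (tens a b) = f a b.
Proof. by rewrite tensor_lift_pi formal_liftU. Qed.

Lemma tensor_liftB : {morph tensor_lift : t u / t - u}.
Proof.
move=> t u; rewrite -[t]reprK -[u]reprK -raddfB /=.
by rewrite !tensor_lift_pi formal_liftB.
Qed.

End Lift.

Lemma tens_balanced : balanced tens.
Proof.
split=> [a a' b|a b b'|a r b]; rewrite /tens -?raddfD; apply/eqP;
  rewrite -Quotient.idealrBE; apply/tensor_relP => I _; apply.
- by rewrite opprD addrA; apply: TensorAddl.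
- by rewrite opprD addrA; apply: TensorAddr.
- exact: TensorBal.
Qed.

Definition tensor_mul : tensor -> S := tensor_lift (fun a b => a * b).

Definition tensor_actl s : tensor -> tensor :=
  tensor_lift (fun a b => tens (s * a) b).

Definition tensor_actr s : tensor -> tensor :=
  tensor_lift (fun a b => tens a (b * s)).

Lemma mul_balanced : balanced (fun a b => a * b).
Proof.
by split=> [a a' b|a b b'|a r b]; [rewrite mulrDl|rewrite mulrDr|rewrite mulrA].
Qed.

Lemma actl_balanced s : balanced (fun a b => tens (s * a) b).
Proof.
have [tDl tDr tM] := tens_balanced.
by split=> [a a' b|a b b'|a r b]; [rewrite mulrDr tDl|rewrite tDr|rewrite mulrA tM].
Qed.

Lemma actr_balanced s : balanced (fun a b => tens a (b * s)).
Proof.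
have [tDl tDr tM] := tens_balanced.
by split=> [a a' b|a b b'|a r b]; [rewrite tDl|rewrite mulrDl tDr|rewrite -mulrA tM].
Qed.

Lemma tensor_mulE a b : tensor_mul (tens a b) = a * b.
Proof. exact/tensor_liftE/mul_balanced. Qed.

Lemma tensor_actlE s a b : tensor_actl s (tens a b) = tens (s * a) b.
Proof. exact/(tensor_liftE (actl_balanced s)). Qed.

Lemma tensor_actrE s a b : tensor_actr s (tens a b) = tens a (b * s).
Proof. exact/(tensor_liftE (actr_balanced s)). Qed.

Lemma tensor_mulB : {morph tensor_mul : t u / t - u}.
Proof. exact/tensor_liftB/mul_balanced. Qed.

Lemma tensor_actlB s : {morph tensor_actl s : t u / t - u}.
Proof. exact/tensor_liftB/actl_balanced. Qed.

Lemma tensor_actrB s : {morph tensor_actr s : t u / t - u}.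
Proof. exact/tensor_liftB/actr_balanced. Qed.

Definition separable_extension : Prop :=
  exists t : tensor, tensor_mul t = 1 /\
    forall s, tensor_actl s t = tensor_actr s t.

End Tensor.

(* Main.v *)
Require Import Defs.
From HB Require Import structures.
From mathcomp Require Import all_boot all_order all_algebra.
From mathcomp Require Import finmap.
From mathcomp Require Import boolp classical_sets cardinality fsbigop.
From mathcomp.multinomials Require Import monalg.

Set Implicit Arguments.
Unset Strict Implicit.
Unset Printing Implicit Defensive.

Import GRing.Theory.

Local Open Scope classical_set_scope.
Local Open Scope ring_scope.
Local Open Scope quotient_scope.

(** The proof rests on the [G]-grading of the crossed product [S].  For each
    [g], the homogeneous elements [du g = 1_g delta_g] and [dv g], of degrees
    [g] and [g^-1], satisfy [du g * dv g = 1_g] and [dv g * du g = 1_(g^-1)]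
    ([du_dv], [dv_du]): they play the role of mutually inverse units, and
    conjugation by them gives [du g * r * dv g = al_g (r 1_(g^-1))]
    ([du_base_dv]).

    Let [r] be central, with [r 1_g = 0] for almost all [g] and trace 1.  The
    separability element is the sum over [g] of the [du g * r (x) dv g].  Its
    image under multiplication is the trace of [r].  If [s] has degree [h],
    left multiplication by [s] carries the term of index [g] to right
    multiplication by [s] of the term of index [h g] ([casimir_shift]): one
    writes [s * du g = du (h g) * b] with [b = dv (h g) * s * du g], which has
    degree 1, hence lies in [R], commutes with [r] and passes through the
    tensor sign.  The two actions of [s] on the sum thus differ only by the
    reindexing [g |-> h g].

    Conversely, let [t] be a separability element.  The balanced maps
    [(x, y) |-> x_g * y_h], where [x_g] denotes a homogeneous component,
    define [tcomp g h] on [S (x)_R S].  Let [r] be [tcomp 1 1 t], which has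
    degree 1 and so lies in [R].  Comparing components in [s t = t s] shows
    that [r] is central (take [s] in [R]) and that
    [du g * r = tcomp g g^-1 t * du g] (take [s = du g]), so that
    [tcomp g g^-1 t = al_g (r 1_(g^-1))].  Almost all of these elements vanish,
    whence the finiteness condition on [r], and they add up to the degree 1
    component of the image of [t] under multiplication ([tcomp_mul]), that is,
    to 1. *)

(** * Additive maps and finitely supported sums *)

Lemma raddf_fsum (I : choiceType) (V W : zmodType) (f : {additive V -> W})
    (F : I -> V) (d : {fset I}) :
  (forall i, i \notin d -> F i = 0) ->
  f (\sum_(i \in [set: I]) F i) = \sum_(i \in [set: I]) f (F i).
Proof.
move=> F0; rewrite (fsbigTE d)// raddf_sum -(fsbigTE d)// => i /F0 ->.
exact: raddf0.
Qed.

(** * The balanced tensor product *)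

Section TensorTheory.
Context (R S : nzRingType) (phi : {rmorphism R -> S}).
Implicit Types (a b s : S) (t u : tensor phi).

(** Closure under differences suffices as [S (x)_R S] is generated by the pure
    tensors as an abelian group. *)
Lemma tensor_ind (P : tensor phi -> Prop) :
  (forall t u, P t -> P u -> P (t - u)) -> (forall a b, P (tens phi a b)) ->
  forall t, P t.
Proof.
move=> PB Pt t.
have P0 : P 0 by rewrite -(subrr (tens phi 0 0)); apply: PB.
have PN u : P u -> P (- u) by move=> Pu; rewrite -sub0r; apply: PB.
have PD u v : P u -> P v -> P (u + v).
  by move=> Pu Pv; rewrite -[v]opprK; apply/PB/PN.
have PMn u n : P u -> P (u *+ n).
  by move=> Pu; elim: n => [|n IHn]; rewrite ?mulr0n// mulrS; apply: PD.
have PMz u (c : int) : P u -> P (u *~ c).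
  case: c => n Pu; first exact: PMn.
  by rewrite NegzE mulrNz; apply/PN/PMn.
rewrite -[t]reprK [repr t]monalgE raddf_sum.
elim/big_ind: _ => // -[a b] _.
rewrite -[X in mkmalgU _ X]intz raddfMz raddfMz.
exact/PMz/Pt.
Qed.

Lemma tensor_mul_zmod_morphism : zmod_morphism (@tensor_mul _ _ phi).
Proof. exact: tensor_mulB. Qed.
HB.instance Definition _ := GRing.isZmodMorphism.Build (tensor phi) S
  (@tensor_mul _ _ phi) tensor_mul_zmod_morphism.

HB.instance Definition _ s := GRing.isZmodMorphism.Build (tensor phi)
  (tensor phi) (@tensor_actl _ _ phi s) (@tensor_actlB _ _ phi s).

HB.instance Definition _ s := GRing.isZmodMorphism.Build (tensor phi)
  (tensor phi) (@tensor_actr _ _ phi s) (@tensor_actrB _ _ phi s).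

Lemma tensor_act_suml (I : Type) (r : seq I) (F : I -> S) t :
  tensor_actl (\sum_(i <- r) F i) t = \sum_(i <- r) tensor_actl (F i) t.
Proof.
have [tDl tDr tM] := tens_balanced phi.
have actD s s' : tensor_actl (s + s') t = tensor_actl s t + tensor_actl s' t.
  elim/tensor_ind: t => [t u IHt IHu|a b].
    by rewrite !raddfB/= IHt IHu opprD addrACA.
  by rewrite !tensor_actlE mulrDl tDl.
apply: (big_morph (fun s => tensor_actl s t) actD).
by apply: (addIr (tensor_actl 0 t)); rewrite -actD !add0r.
Qed.

Lemma tensor_act_sumr (I : Type) (r : seq I) (F : I -> S) t :
  tensor_actr (\sum_(i <- r) F i) t = \sum_(i <- r) tensor_actr (F i) t.
Proof.
have [tDl tDr tM] := tens_balanced phi.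
have actD s s' : tensor_actr (s + s') t = tensor_actr s t + tensor_actr s' t.
  elim/tensor_ind: t => [t u IHt IHu|a b].
    by rewrite !raddfB/= IHt IHu opprD addrACA.
  by rewrite !tensor_actrE mulrDr tDr.
apply: (big_morph (fun s => tensor_actr s t) actD).
by apply: (addIr (tensor_actr 0 t)); rewrite -actD !add0r.
Qed.

End TensorTheory.

(** * The grading of the crossed product *)

Section Grading.
Context (G : groupType) (R : nzRingType) (A : twisted_partial_action G R).
Local Notation D := (tpa_dom A).
Local Notation "''1_' g" := (tpa_id A g) (at level 8, g at level 2).
Local Notation al := (tpa_map A).
Local Notation w := (tpa_coc A).
Local Notation wV := (tpa_cocV A).
Local Notation S := (crossed_product A).
Local Notation base := (cp_base A).
Implicit Types (g h k : G) (a b c r : R) (s x y : S).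

(** Multiplying by [1_g] makes [delta g] a total additive map from [R] onto the
    component of degree [g]. *)
Definition delta g r : S := CrossedProduct (cp_predU (tpa_dom_idr A g r)).

Lemma deltaM g r h a :
  delta g r * delta h a = delta (g * h)%g (cp_coef A g h (r * '1_g) (a * '1_h)).
Proof.
apply/val_inj; rewrite /= cp_mul_rawU.
by rewrite (tpa_idr (cp_coef_dom _ _ _ _ _)).
Qed.

Lemma delta1E r : delta 1%g r = base r.
Proof. by apply/val_inj; rewrite /= tpa_id1 mulr1. Qed.

Lemma delta_inv g h r a : (g * h)%g = 1%g ->
  exists b, delta g r * delta h a = base b.
Proof. by move=> gh; rewrite deltaM gh delta1E; eexists. Qed.

Lemma delta_zmod_morphism g : zmod_morphism (delta g).
Proof. by move=> r a; apply/val_inj; rewrite /= mulrBl monalgUB. Qed.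
HB.instance Definition _ g :=
  GRing.isZmodMorphism.Build R S (delta g) (delta_zmod_morphism g).

Definition hcomp g x : S := delta g (cp_val x)@_g.

Lemma hcomp_zmod_morphism g : zmod_morphism (hcomp g).
Proof. by move=> x y; rewrite /hcomp/= mcoeffB raddfB. Qed.
HB.instance Definition _ g :=
  GRing.isZmodMorphism.Build S S (hcomp g) (hcomp_zmod_morphism g).

Lemma hcomp_delta g h r :
  hcomp g (delta h r) = if h == g then delta h r else 0.
Proof.
rewrite /hcomp/= mcoeffU; case: eqP => [->|_]; last exact: raddf0.
by apply/val_inj; rewrite /= mulr1n (tpa_idr (tpa_dom_idr _ _ _)).
Qed.

Lemma hcomp_out g x : g \notin msupp (cp_val x) -> hcomp g x = 0.
Proof. by move=> /mcoeff_outdom xg; rewrite /hcomp xg raddf0. Qed.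

Lemma hcomp1E x : hcomp 1%g x = base (cp_val x)@_1%g.
Proof. exact: delta1E. Qed.

Lemma hcomp_sum x : x = \sum_(g <- msupp (cp_val x)) hcomp g x.
Proof.
have /cp_predP xD := cp_valP x.
apply/val_inj; rewrite raddf_sum [LHS]monalgE.
by apply: eq_bigr => g _; rewrite /= tpa_idr.
Qed.

Lemma hcomp_deltaMl h r g x :
  hcomp (h * g)%g (delta h r * x) = delta h r * hcomp g x.
Proof.
rewrite [x]hcomp_sum mulr_sumr !raddf_sum mulr_sumr; apply: eq_bigr => k _.
rewrite /= [hcomp k x]/hcomp deltaM !hcomp_delta (inj_eq (@mulgI _ h)).
by case: eqP; rewrite ?mulr0// deltaM.
Qed.

Lemma hcomp_deltaMr h r g x :
  hcomp (g * h)%g (x * delta h r) = hcomp g x * delta h r.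
Proof.
rewrite [x]hcomp_sum mulr_suml !raddf_sum mulr_suml; apply: eq_bigr => k _.
rewrite /= [hcomp k x]/hcomp deltaM !hcomp_delta (inj_eq (@mulIg _ h)).
by case: eqP; rewrite ?mul0r// deltaM.
Qed.

Lemma hcomp_baseMl a g x : hcomp g (base a * x) = base a * hcomp g x.
Proof. by rewrite -delta1E -hcomp_deltaMl mul1g. Qed.

Lemma hcomp_baseMr a g x : hcomp g (x * base a) = hcomp g x * base a.
Proof. by rewrite -delta1E -hcomp_deltaMr mulg1. Qed.

Lemma base_deltaM a g r : base a * delta g r = delta g (a * r).
Proof.
rewrite -delta1E; apply/val_inj; rewrite /= cp_mul_rawU mul1g /cp_coef.
rewrite tpa_map1 tpa_coc1g invg1 tpa_id1 !mulr1 -!mulrA.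
by rewrite (tpa_idl (tpa_id_dom A g)).
Qed.

Lemma delta_id g r : delta g (r * '1_g) = delta g r.
Proof. by apply/val_inj; rewrite /= (tpa_idr (tpa_dom_idr _ _ _)). Qed.

Lemma base_id_delta g r : base '1_g * delta g r = delta g r.
Proof. by rewrite base_deltaM tpa_idC delta_id. Qed.

Lemma delta_base g r a :
  delta g r * base a = base (r * al g (a * '1_(g^-1)%g)) * delta g 1.
Proof.
rewrite -delta1E base_deltaM; apply/val_inj; rewrite /= cp_mul_rawU mulg1.
rewrite /cp_coef tpa_cocg1 tpa_id1 !mulr1.
have Dal := tpa_map_domP (tpa_dom_idr A g^-1%g a).
by rewrite -(mulrA r '1_g) (tpa_idl Dal).
Qed.

(** Since [al_h (1_g 1_(h^-1)) = 1_h 1_(h g)], the elements [1_g] are permuted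
    by homogeneous elements as translation permutes their indices. *)
Lemma delta_base_id h r g :
  delta h r * base '1_g = base '1_(h * g)%g * delta h r.
Proof.
rewrite delta_base !base_deltaM mulr1 (tpa_idC A g) tpa_map_id mulrA tpa_idAC.
by rewrite delta_id (tpa_idC A (h * g)%g).
Qed.

(** * Homogeneous quasi-units *)

(** The twist [w] prevents [delta g^-1 1] from being inverse to [delta g 1] up
    to idempotents; the factor [wV g^-1 g] in [dv] corrects it. *)
Definition du g : S := delta g 1.
Definition dv g : S := delta g^-1%g (wV g^-1%g g).

(** The product is [al_g q * w g g^-1] for [q = wV g^-1 g].  The cocycle
    identity at [g, g^-1, g], applied to [q], shows that this is the image
    under [al_g] of [q * w g^-1 g = 1_(g^-1)]. *)
Lemma du_dv g : du g * dv g = base '1_g.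
Proof.
set q := wV g^-1%g g.
have Dq : D g^-1%g q := mul_dom_l (tpa_cocV_dom A g^-1%g g).
have Hq : mul_set (mul_set (D g^-1%g) (D g^-1%g)) (D (g^-1 * g)%g) q.
  rewrite -[q]mulr1; apply: mul_setM; first exact: mul_domP.
  by rewrite mulVg tpa_dom1.
have := tpa_cocycle Hq; rewrite tpa_cocVK mulVg tpa_cocg1 mulgV tpa_coc1g.
have Dw : D g (w g g^-1%g) := mul_dom_l (tpa_coc_dom A g g^-1%g).
rewrite tpa_map_id mulg1 !(tpa_idl (tpa_id_dom A g)) -mulrA (tpa_idr Dw) => E.
rewrite /du /dv deltaM mulgV delta1E -/q; congr base.
rewrite /cp_coef mul1r !(tpa_idr Dq).
by rewrite -mulrA -E (tpa_idl (tpa_id_dom A g)).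
Qed.

Lemma dv_du g : dv g * du g = base '1_(g^-1)%g.
Proof.
have Dw := mul_dom_l (tpa_coc_dom A g^-1%g g).
have Dv := mul_dom_l (tpa_cocV_dom A g^-1%g g).
rewrite /du /dv deltaM mulVg delta1E; congr base.
rewrite /cp_coef mul1r (tpa_idr Dv) -{1}[g in '1_g]invgK tpa_idC tpa_map_id invgK.
rewrite mulVg tpa_id1 mulr1 -mulrA (tpa_idl Dw) tpa_cocVK mulVg tpa_id1.
exact: mulr1.
Qed.

Lemma du_base_id g : du g * base '1_(g^-1)%g = du g.
Proof. by rewrite -dv_du mulrA du_dv base_id_delta. Qed.

Lemma dv_base_id g : dv g * base '1_g = dv g.
Proof. by rewrite -du_dv mulrA dv_du base_id_delta. Qed.

Lemma du_base g r : du g * base r = base (al g (r * '1_(g^-1)%g)) * du g.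
Proof. by rewrite /du delta_base mul1r. Qed.

Lemma du_base_dv g r : du g * base r * dv g = base (al g (r * '1_(g^-1)%g)).
Proof.
rewrite du_base -mulrA du_dv -rmorphM (tpa_idr (tpa_map_domP _))//.
exact: tpa_dom_idr.
Qed.

(** * From an element of trace one to a separability element *)

Section Casimir.
Variable r : R.
Hypothesis rC : center r.

Definition casimir_term g : tensor base := tens base (du g * base r) (dv g).

(** [dv (h g) * s * du g] has degree [(h g)^-1 h g = 1], so it belongs to [R]
    and can be moved across the tensor sign. *)
Lemma casimir_shift h a g :
  tensor_actl (delta h a) (casimir_term g) =
  tensor_actr (delta h a) (casimir_term (h * g)%g).
Proof.
have [_ _ tM] := tens_balanced base.
rewrite /casimir_term tensor_actlE tensor_actrE; set s := delta h a.
have [b bE] : exists b, dv (h * g)%g * s * du g = base b.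
  rewrite /dv /s /du deltaM; apply: delta_inv.
  by rewrite invgM -!mulgA mulKg mulVg.
have sE : s * du g = du (h * g)%g * base b.
  by rewrite -bE !mulrA du_dv -delta_base_id -mulrA base_id_delta.
have bv : base b * dv g = dv (h * g)%g * s.
  by rewrite -bE -!mulrA du_dv delta_base_id mulrA dv_base_id.
have bC : base b * base r = base r * base b by rewrite -!rmorphM (rC b).
by rewrite mulrA sE -mulrA bC mulrA tM bv.
Qed.

Lemma casimir_term0 g : r * '1_(g^-1)%g = 0 -> casimir_term g = 0.
Proof.
have [tDl _ _] := tens_balanced base.
move=> r0; rewrite /casimir_term -du_base_id -mulrA -rmorphM tpa_idC r0.
rewrite rmorph0 mulr0.
by apply: (addIr (tens base 0 (dv g))); rewrite -tDl !add0r.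
Qed.

End Casimir.

Lemma separable_of_trace r : center_fin A r -> trace A r = 1 ->
  separable_extension base.
Proof.
move=> [rC rfin] tr1.
(* The term of index g vanishes as soon as r 1_(g^-1) does, hence outside the
   set of inverses of the support of r. *)
pose d := ([fset g^-1%g | g in fset_set [set g | r * '1_g != 0]%classic])%fset.
have dP g : g \notin d -> r * '1_(g^-1)%g = 0.
  apply: contraNeq => r0; apply/imfsetP; exists g^-1%g; rewrite ?invgK//=.
  by rewrite in_fset_set// inE.
have T0 g : g \notin d -> casimir_term r g = 0.
  by move=> /dP; apply: casimir_term0.
exists (\sum_(g \in [set: G]) casimir_term r g); split.
  rewrite (raddf_fsum _ T0) /= -(rmorph1 base) -tr1 (raddf_fsum _ (d := d)).
    apply: eq_fsbigr => g _.
    by rewrite /casimir_term tensor_mulE du_base_dv.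
  by move=> g /dP ->; rewrite tpa_map0.
move=> s; rewrite [s]hcomp_sum tensor_act_suml tensor_act_sumr.
apply: eq_bigr => h _; rewrite !(raddf_fsum _ T0) /=.
rewrite [RHS](reindex_fsbigT (fun g => h * g)%g); last first.
  by exists (fun g => h^-1 * g)%g => g; rewrite ?mulKg ?mulVKg.
by apply: eq_fsbigr => g _; apply: casimir_shift.
Qed.

(** * From a separability element to an element of trace one *)

Definition comp_mul g h x y : S := hcomp g x * hcomp h y.

Lemma comp_mul_balanced g h : balanced base (comp_mul g h).
Proof.
split=> [x x' y|x y y'|x r y]; rewrite /comp_mul ?raddfD/= ?mulrDl ?mulrDr//.
by rewrite hcomp_baseMl hcomp_baseMr mulrA.
Qed.

Definition tcomp g h : tensor base -> S := tensor_lift (comp_mul g h).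

HB.instance Definition _ g h := GRing.isZmodMorphism.Build (tensor base) S
  (tcomp g h) (tensor_liftB (comp_mul_balanced g h)).

Lemma tcompE g h x y : tcomp g h (tens base x y) = hcomp g x * hcomp h y.
Proof. exact/tensor_liftE/comp_mul_balanced. Qed.

Lemma tcomp_actl k a g h t :
  tcomp (k * g)%g h (tensor_actl (delta k a) t) = delta k a * tcomp g h t.
Proof.
elim/tensor_ind: t => [t u IHt IHu|x y]; first by rewrite !raddfB/= IHt IHu mulrBr.
by rewrite tensor_actlE !tcompE hcomp_deltaMl mulrA.
Qed.

Lemma tcomp_actr k a g h t :
  tcomp g (h * k)%g (tensor_actr (delta k a) t) = tcomp g h t * delta k a.
Proof.
elim/tensor_ind: t => [t u IHt IHu|x y].
  by rewrite !raddfB/= IHt IHu mulrBl.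
by rewrite tensor_actrE !tcompE hcomp_deltaMr mulrA.
Qed.

Lemma hcomp_tcomp g h t : hcomp (g * h)%g (tcomp g h t) = tcomp g h t.
Proof.
elim/tensor_ind: t => [t u IHt IHu|x y]; first by rewrite !raddfB/= IHt IHu.
by rewrite tcompE /hcomp deltaM -/(hcomp _ _) hcomp_delta eqxx.
Qed.

Lemma id_tcomp g h t : base '1_g * tcomp g h t = tcomp g h t.
Proof.
elim/tensor_ind: t => [t u IHt IHu|x y].
  by rewrite !raddfB/= mulrBr IHt IHu.
by rewrite tcompE mulrA base_id_delta.
Qed.

(** On a pure tensor [x (x) y] this is the expansion of the degree 1 component
    of [x * y] along the homogeneous components of [x]. *)
Lemma tcomp_mul t : exists d : {fset G},
  (forall g, g \notin d -> tcomp g g^-1%g t = 0) /\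
  hcomp 1%g (tensor_mul t) = \sum_(g \in [set: G]) tcomp g g^-1%g t.
Proof.
(* Allowing any larger index set makes the claim stable under differences. *)
suff [d [d0 dE]] : exists d : {fset G},
  (forall g, g \notin d -> tcomp g g^-1%g t = 0) /\
  forall e : {fset G}, (d `<=` e)%fset ->
    hcomp 1%g (tensor_mul t) = \sum_(g <- e) tcomp g g^-1%g t.
  by exists d; split; rewrite // (fsbigTE d)//; apply: dE.
elim/tensor_ind: t => [t u [d [d0 dE]] [e [e0 eE]]|x y].
  exists (d `|` e)%fset; split=> [g|f].
    by rewrite inE negb_or => /andP[/d0 t0 /e0 u0]; rewrite raddfB/= t0 u0 subr0.
  rewrite fsubUset => /andP[/dE dfE /eE efE]; rewrite !raddfB/= dfE efE -sumrB.
  by apply: eq_bigr => g _; rewrite raddfB.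
have x0 g : g \notin msupp (cp_val x) -> tcomp g g^-1%g (tens base x y) = 0.
  by move=> /hcomp_out; rewrite tcompE => ->; rewrite mul0r.
exists (msupp (cp_val x)); split=> [//|e xe].
rewrite -(big_fset_incl _ xe) => [|g _ /x0//] /=.
rewrite tensor_mulE {1}[x]hcomp_sum mulr_suml raddf_sum/=.
apply: eq_bigr => g _; rewrite tcompE -(mulgV g).
exact: hcomp_deltaMl.
Qed.

Lemma trace_of_separable : separable_extension base ->
  exists2 r, center_fin A r & trace A r = 1.
Proof.
move=> [t [mt tC]].
have [d [d0 dE]] := tcomp_mul t.
pose r := (cp_val (tcomp 1%g 1%g t))@_1%g.
have rE : tcomp 1%g 1%g t = base r.
  by rewrite -hcomp1E -[in LHS]hcomp_tcomp mulg1.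
(* Compare the components of bidegree (g, 1) in du g * t = t * du g. *)
have alE g : base (al g (r * '1_(g^-1)%g)) = tcomp g g^-1%g t.
  have cu : du g * base r = tcomp g g^-1%g t * du g.
    by rewrite -rE -tcomp_actl tC -tcomp_actr mulg1 mulVg.
  rewrite -du_base_dv cu -mulrA du_dv -[in RHS]id_tcomp.
  rewrite -hcomp_tcomp mulgV hcomp1E -!rmorphM; congr base.
  by rewrite tpa_idC.
exists r; last first.
  apply: (@cp_base_inj _ _ A); rewrite rmorph1 (raddf_fsum _ (d := d)).
    rewrite (eq_fsbigr (fun g => tcomp g g^-1%g t)) => [|g _]; last exact: alE.
    have S1 : (1 : S) = delta 1%g 1 by rewrite delta1E.
    by rewrite -dE mt S1 hcomp_delta eqxx.
  by move=> g /d0; rewrite -alE => /(congr1 (fun x => (cp_val x)@_1%g));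
    rewrite /= mcoeffUU mcoeff0.
split=> [a|].
  (* Compare the components of bidegree (1, 1) in a * t = t * a. *)
  apply: (@cp_base_inj _ _ A); rewrite !rmorphM /= -rE -delta1E.
  have := tcomp_actl 1%g a 1%g 1%g t; rewrite tC mulg1 => <-.
  by rewrite -tcomp_actr mulg1.
(* al_(g^-1) is injective on D_g and maps r 1_g to the component of t of
   bidegree (g^-1, g), which vanishes for almost all g. *)
apply: sub_finite_set (finite_fset [fset g^-1%g | g in d]%fset) => g /=.
apply: contra_neqP => /negP gd.
have gd' : g^-1%g \notin d.
  by apply: contra gd => gd; apply/imfsetP; exists g^-1%g; rewrite ?invgK.
have := alE g^-1%g; rewrite (d0 _ gd') invgK -(rmorph0 base) => /cp_base_inj E.
have [_ inj _] := tpa_map_bij A g^-1%g.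
apply: (inj); rewrite ?inE ?invgK ?tpa_map0//; last exact: tpa_dom0.
exact: tpa_dom_idr.
Qed.

End Grading.

Theorem theorem35 (G : groupType) (R : nzRingType)
    (A : twisted_partial_action G R) :
  separable_extension (cp_base A) <->
  [set trace A r | r in center_fin A] 1.
Proof.
split=> [/trace_of_separable[r rfin tr1]|[r rfin tr1]]; first by exists r.
exact: separable_of_trace rfin tr1.
Qed.
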